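(* If $\mathcal{L}=J(P)$ for some finite poset $P$ and, for $X\subseteq P$, $\tau(X)$ is the intersection of all the order ideals in $J(P)$ containing $X$, then cover-closure $\xi:\mathcal{L}\to\mathcal{L}$ is rowmotion on $J(P)$.
   Context: An order ideal of a poset $P$ is a subset $I\subseteq P$ such that $y\in I$ and $x\le y$ imply $x\in I$; $J(P)\subseteq 2^P$ is the set of order ideals of $P$. The map $\tau:2^P\to 2^P$ in the claim is a closure operator whose set of closed sets is $J(P)$. For a closure operator $\tau$ on a ground set $E$ with set of closed sets $\mathcal{L}$ and $X\in 2^E$, $\mathrm{cov}(X)=\{e\in E\setminus X\mid X\cup\{e\}\in\mathcal{L}\}$, and cover-closure is $\xi:\mathcal{L}\to\mathcal{L}$, $\xi(X)=\tau(\mathrm{cov}(X))$. The rowmotion of $I\in J(P)$ is the order ideal generated by the minimal elements of $P\setminus I$. *)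

(* Defs.v *)
From mathcomp Require Import all_boot all_order.

Set Implicit Arguments.
Unset Strict Implicit.
Unset Printing Implicit Defensive.

Import Order.TTheory.
Local Open Scope order_scope.

Section ClosureOperators.
Variable E : finType.

Record closure_operator := ClosureOperator {
  clos :> {set E} -> {set E};
  clos_extensive : forall X : {set E}, X \subset clos X;
  clos_monotone : forall X Y : {set E}, X \subset Y -> clos X \subset clos Y;
  clos_idempotent : forall X : {set E}, clos (clos X) = clos X
}.

Definition closed_sets (tau : closure_operator) : {set {set E}} :=
  [set X | tau X == X].

Definition cov (tau : closure_operator) (X : {set E}) : {set E} :=
  [set e in ~: X | X :|: [set e] \in closed_sets tau].

(* A total function on {set E}; the cover-closure map of the closure space is
   its restriction closed_sets tau -> closed_sets tau (see
   cover_closure_closed). *)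
Definition cover_closure (tau : closure_operator) (X : {set E}) : {set E} :=
  tau (cov tau X).

Lemma cover_closure_closed tau X : cover_closure tau X \in closed_sets tau.
Proof. by rewrite inE clos_idempotent. Qed.

End ClosureOperators.

Section Ideals.
Variables (disp : Order.disp_t) (P : finPOrderType disp).

Definition order_ideal (I : {set P}) : bool :=
  [forall y in I, forall x, (x <= y) ==> (x \in I)].

Definition order_ideals : {set {set P}} := [set I | order_ideal I].

Definition generated_ideal (A : {set P}) : {set P} :=
  [set x | [exists y in A, x <= y]].

Definition minimal_elements (A : {set P}) : {set P} :=
  [set x in A | ~~ [exists y in A, y < x]].

(* A total function on {set P}; rowmotion is its restriction
   order_ideals -> order_ideals (see rowmotion_order_ideal). *)
Definition rowmotion (I : {set P}) : {set P} :=
  generated_ideal (minimal_elements (~: I)).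

Lemma order_idealP (I : {set P}) :
  reflect (forall x y, y \in I -> x <= y -> x \in I) (I \in order_ideals).
Proof.
rewrite inE; apply: (iffP forall_inP) => [h x y yI xy | h y yI].
  by have /forallP/(_ x)/implyP := h y yI; apply.
by apply/forallP => x; apply/implyP; apply: h yI.
Qed.

Lemma generated_ideal_order_ideal A : generated_ideal A \in order_ideals.
Proof.
apply/order_idealP => x y; rewrite !inE => /exists_inP[z zA yz] xy.
by apply/exists_inP; exists z => //; apply: le_trans yz.
Qed.

Lemma generated_ideal_extensive (A : {set P}) : A \subset generated_ideal A.
Proof.
by apply/subsetP => x xA; rewrite inE; apply/exists_inP; exists x.
Qed.

Lemma generated_ideal_least (A I : {set P}) :
  I \in order_ideals -> A \subset I -> generated_ideal A \subset I.
Proof.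
move=> /order_idealP hI /subsetP AI; apply/subsetP => x.
by rewrite inE => /exists_inP[y /AI yI xy]; apply: hI xy.
Qed.

Lemma rowmotion_order_ideal I : rowmotion I \in order_ideals.
Proof. exact: generated_ideal_order_ideal. Qed.

(* The intersection of all order ideals containing X is a closure operator,
   and its closed sets are the order ideals. *)
Definition ideal_hull (X : {set P}) : {set P} :=
  \bigcap_(I in order_ideals | X \subset I) I.

Lemma ideal_hull_extensive (X : {set P}) : X \subset ideal_hull X.
Proof. by apply/bigcapsP => I /andP[]. Qed.

Lemma ideal_hull_monotone (X Y : {set P}) :
  X \subset Y -> ideal_hull X \subset ideal_hull Y.
Proof.
move=> XY; apply/bigcapsP => I /andP[hI YI]; apply: bigcap_inf.
by rewrite hI (subset_trans XY YI).
Qed.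

Lemma ideal_hull_order_ideal (X : {set P}) : ideal_hull X \in order_ideals.
Proof.
apply/order_idealP => x y /bigcapP yX xy; apply/bigcapP => I hI.
by have /andP[/order_idealP dI _] := hI; apply: dI xy; apply: yX.
Qed.

Lemma ideal_hull_id (I : {set P}) : I \in order_ideals -> ideal_hull I = I.
Proof.
move=> hI; apply/eqP; rewrite eqEsubset ideal_hull_extensive andbT.
by apply: bigcap_inf; rewrite hI subxx.
Qed.

Lemma ideal_hull_idempotent (X : {set P}) :
  ideal_hull (ideal_hull X) = ideal_hull X.
Proof. exact: ideal_hull_id (ideal_hull_order_ideal X). Qed.

Definition ideal_closure : closure_operator P :=
  ClosureOperator ideal_hull_extensive ideal_hull_monotone
    ideal_hull_idempotent.

Lemma closed_sets_ideal_closure : closed_sets ideal_closure = order_ideals.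
Proof.
apply/setP => X; rewrite [LHS]inE; apply/eqP/idP => [<-|].
  exact: ideal_hull_order_ideal.
exact: ideal_hull_id.
Qed.

End Ideals.

Arguments order_ideals {disp} P.

(* Main.v *)
(** An element [e] outside an order ideal [I] can be added to [I] to give an
    order ideal iff everything strictly below [e] is already in [I], i.e. iff
    [e] is minimal in the complement of [I].  So [cov I] is the set of minimal
    elements of the complement, and its hull is the ideal it generates. *)
Require Import Defs.
From mathcomp Require Import all_boot all_order.

Import Order.TTheory.

(** The generated ideal is one of the ideals being intersected; conversely, the hull is an ideal
    containing [X], and the generated ideal is the least such. *)
Lemma ideal_hullE (disp : Order.disp_t) (P : finPOrderType disp)
    (X : {set P}) :
  ideal_hull X = generated_ideal X.
Proof.
apply/eqP; rewrite eqEsubset; apply/andP; split.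
  apply: bigcap_inf.
  by rewrite generated_ideal_order_ideal generated_ideal_extensive.
exact: generated_ideal_least (ideal_hull_order_ideal X)
  (ideal_hull_extensive X).
Qed.

Lemma cov_minimal_elements (disp : Order.disp_t) (P : finPOrderType disp)
    (tau : closure_operator P) (I : {set P}) :
  closed_sets tau = order_ideals P -> I \in order_ideals P ->
  cov tau I = minimal_elements (~: I).
Proof.
move=> closed_tau /order_idealP idI; apply/setP => e.
rewrite [LHS]inE [RHS]inE closed_tau; case: (boolP (e \in ~: I)) => //= eNI.
apply/order_idealP/exists_inPn => [idIe y yNI | mine x y].
  (* Being below [e], [y] lies in the ideal [I :|: [set e]]; as [y] differs from [e], it is in
     [I]. *)
  apply/negP => ye; have: y \in I :|: [set e].
    by apply: idIe (ltW ye); rewrite !inE eqxx orbT.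
  by move: yNI; rewrite !inE (lt_eqF ye) orbF => /negbTE->.
rewrite !inE => /orP[yI xy | /eqP-> ]; first by rewrite (idI _ _ yI xy).
rewrite le_eqVlt => /orP[-> | xe]; first by rewrite orbT.
(* An [x < e] outside [I] would contradict the minimality of [e]. *)
by apply/orP; left; apply: contraLR xe => xNI; apply: mine; rewrite inE.
Qed.

Theorem lemma4p7 (disp : Order.disp_t) (P : finPOrderType disp)
    (tau : closure_operator P)
    (closed_tau : closed_sets tau = order_ideals P)
    (tauE : forall X : {set P},
      tau X = \bigcap_(I in order_ideals P | X \subset I) I) :
  forall I : {set P}, I \in order_ideals P ->
    cover_closure tau I = rowmotion I.
Proof.
move=> I idI; rewrite /cover_closure /rowmotion cov_minimal_elements //.
(* The intersection given by [tauE] is [ideal_hull] unfolded. *)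
by rewrite tauE -ideal_hullE.
Qed.
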